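(* For any family of Boolean functions $F = \{f_n\}_{n \in \mathbb{N}}$, $\mathcal{L}^{\mathrm{NBP}}_F(n), \mathcal{L}^{\oplus\mathrm{BP}}_F(n) \in O\Bigl(\frac{n^{3/2}}{\log_2 n}\Bigr)$.
   Context: For an $n$-ary Boolean function $f$ and $V \subseteq [n]$, $r_V(f)$ denotes the number of distinct subfunctions of $f$ on $V$ obtained by fixing the variables outside $V$. A complexity measure $\mathbf{M}$ assigns a natural number to every Boolean function. A Nečiporuk function for $\mathbf{M}$ is a non-decreasing $b\colon \mathbb{N}_{>0}\to\mathbb{N}$ such that for every $n$, every $n$-ary Boolean function $f$ and every partition $V_1,\dots,V_p$ of $[n]$, $\mathbf{M}(f) \ge \sum_{i=1}^p b(r_{V_i}(f))$; $\mathcal{N}_{\mathbf{M}}$ is the set of all such functions. The best lower bound achievable by Nečiporuk's method for $F$ and $\mathbf{M}$ is $\mathcal{L}^{\mathbf{M}}_F(n) = \max\{\sum_{i=1}^p b(r_{V_i}(f_n)) \mid b \in \mathcal{N}_{\mathbf{M}},\ V_1,\dots,V_p \text{ partition of } [n]\}$. $\mathrm{NBP}(f)$ (resp. $\oplus\mathrm{BP}(f)$) is the minimum number of non-sink vertices of a nondeterministic (resp. parity) branching program computing $f$: a directed graph with start vertex, sinks $t_0,t_1$, non-sink vertices labelled by variables and arcs labelled $0/1$, accepting iff some (resp. an odd number of) path(s) consistent with the input lead from the start to $t_1$. *)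

(* Defs.v *)
From HB Require Import structures.
From mathcomp Require Import all_boot all_order all_algebra.
From mathcomp Require Import all_classical all_reals all_analysis.

Set Implicit Arguments.
Unset Strict Implicit.
Unset Printing Implicit Defensive.

Import Order.TTheory GRing.Theory Num.Theory.
Import numFieldNormedType.Exports.

Local Open Scope card_scope.
Local Open Scope classical_set_scope.
Local Open Scope nat_scope.

Definition input (n : nat) := {ffun 'I_n -> bool}.

Definition boolfun (n : nat) := {ffun input n -> bool}.

Definition merge (n : nat) (V : {set 'I_n})
    (y : {ffun {i : 'I_n | i \in V} -> bool})
    (rho : {ffun {i : 'I_n | i \notin V} -> bool}) : input n :=
  [ffun i => match boolP (i \in V) with
             | AltTrue iV => y (exist _ i iV)
             | AltFalse iV => rho (exist _ i iV)
             end].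

Definition subfunction (n : nat) (f : boolfun n) (V : {set 'I_n})
    (rho : {ffun {i : 'I_n | i \notin V} -> bool}) :
    {ffun {ffun {i : 'I_n | i \in V} -> bool} -> bool} :=
  [ffun y => f (merge y rho)].

Definition nb_subfunctions (n : nat) (V : {set 'I_n}) (f : boolfun n) : nat :=
  #|[set subfunction f rho | rho : {ffun {i : 'I_n | i \notin V} -> bool}]%SET|.

Definition complexity_measure := forall n : nat, boolfun n -> nat.

Definition neciporuk_sum (b : nat -> nat) (n : nat) (f : boolfun n)
    (P : {set {set 'I_n}}) : nat :=
  \sum_(V in P) b (nb_subfunctions V f).

(* b is only meaningful on positive arguments: nb_subfunctions is never 0, and
   nothing is required of b 0. *)
Definition neciporuk_function (M : complexity_measure) (b : nat -> nat) : Prop :=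
  (forall m m' : nat, 0 < m -> m <= m' -> b m <= b m') /\
  (forall (n : nat) (f : boolfun n) (P : {set {set 'I_n}}),
     finset.partition P [set: 'I_n]%SET -> neciporuk_sum b f P <= M n f).

Definition achievable (M : complexity_measure) (n : nat) (f : boolfun n)
    (l : nat) : Prop :=
  exists (b : nat -> nat) (P : {set {set 'I_n}}),
    [/\ neciporuk_function M b, finset.partition P [set: 'I_n]%SET
      & neciporuk_sum b f P = l].

Lemma achievable_ex (M : complexity_measure) (n : nat) (f : boolfun n) :
  exists l, `[< achievable M f l >].
Proof.
have sum0 m (g : boolfun m) (P : {set {set 'I_m}}) :
  neciporuk_sum (fun=> 0) g P = 0 by apply: big1.
exists 0; apply/asboolP.
exists (fun=> 0), (finset.preim_partition id [set: 'I_n]%SET).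
by split; rewrite ?finset.preim_partitionP//; split=> // m g P _; rewrite sum0.
Qed.

Lemma achievable_bounded (M : complexity_measure) (n : nat) (f : boolfun n) l :
  `[< achievable M f l >] -> l <= M n f.
Proof. by move=> /asboolP[b [P [[_ bM] PT <-]]]; apply: bM. Qed.

Definition best_bound (M : complexity_measure) (F : forall n : nat, boolfun n)
    (n : nat) : nat :=
  ex_maxn (achievable_ex M (F n)) (@achievable_bounded M n (F n)).

(* inl q is the non-sink vertex q, inr c is the sink t_c.  Parallel arcs with
   the same label are not represented. *)
Record branching_program (n : nat) := BranchingProgram {
  bp_node : finType;
  bp_start : bp_node + bool;
  bp_var : bp_node -> 'I_n;
  bp_arc : bp_node -> bool -> pred (bp_node + bool)
}.

Definition bp_size (n : nat) (B : branching_program n) : nat := #|bp_node B|.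

Definition bp_step (n : nat) (B : branching_program n) (x : input n) :
    rel (bp_node B + bool) :=
  fun u v => if u is inl q then bp_arc q (x (bp_var q)) v else false.

(* The start vertex itself is left out of the list p of visited vertices. *)
Definition accepting_path (n : nat) (B : branching_program n) (x : input n)
    (p : seq (bp_node B + bool)) : Prop :=
  path (bp_step x) (bp_start B) p /\ last (bp_start B) p = inr true.

Definition acceptance := forall n : nat, branching_program n -> input n -> Prop.

Definition nondet_accepts : acceptance :=
  fun n B x => exists p, @accepting_path n B x p.

(* The graph may have cycles; an infinite number of paths is not odd. *)
Definition parity_accepts : acceptance :=
  fun n B x => exists2 k : nat, odd k & [set p | @accepting_path n B x p] #= `I_k.

Definition computes (acc : acceptance) (n : nat) (B : branching_program n)
    (f : boolfun n) : Prop :=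
  forall x : input n, acc n B x <-> f x.

Definition has_bp_of_size (acc : acceptance) (n : nat) (f : boolfun n)
    (s : nat) : Prop :=
  exists2 B : branching_program n, bp_size B = s & computes acc B f.

Section DecisionTree.
Variables (n : nat) (f : boolfun n).

Let node (k : nat) (a : input n) : ('I_n * input n) + bool :=
  if insub k is Some i then inl (i, a) else inr (f a).

Definition tree_bp : branching_program n :=
  @BranchingProgram n _ (node 0 [ffun=> false]) (fun q => q.1)
    (fun q c v =>
       v == node q.1.+1 [ffun j => if j == q.1 then c else q.2 j]).

Lemma tree_bp_path (x : input n) :
  exists p : seq (bp_node tree_bp + bool),
    [/\ path (bp_step x) (bp_start tree_bp) p,
        last (bp_start tree_bp) p = inr (f x)
      & forall q c, path (bp_step x) (bp_start tree_bp) q ->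
          last (bp_start tree_bp) q = inr c -> q = p].
Proof.
have gen d k (a : input n) : k + d = n ->
  (forall j : 'I_n, j < k -> a j = x j) ->
  exists p : seq (bp_node tree_bp + bool),
    [/\ path (@bp_step n tree_bp x) (node k a) p,
        last (node k a) p = inr (f x)
      & forall q c, path (@bp_step n tree_bp x) (node k a) q ->
          last (node k a) q = inr c -> q = p].
  elim: d k a => [|d IH] k a.
    rewrite addn0 => -> ax.
    have -> : a = x by apply/ffunP => j; apply: ax.
    rewrite /node insubF ?ltnn//.
    by exists [::]; split=> // -[].
  move=> kd ax.
  have kn : k < n by rewrite -kd addnS ltnS leq_addr.
  pose i := Ordinal kn.
  have nodeE : node k a = inl (i, a) by rewrite /node insubT.
  pose a' : input n := [ffun j => if j == i then x i else a j].
  have [|j|p [pp lp up]] := IH k.+1 a'; first by rewrite addSnnS.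
    rewrite ltnS leq_eqVlt ffunE -val_eqE /= => /orP[/eqP jk|jk].
      by rewrite jk eqxx; congr (x _); apply: val_inj; rewrite /= jk.
    by rewrite ltn_eqF// ax.
  exists (node k.+1 a' :: p); rewrite nodeE; split=> //=.
    by rewrite eqxx.
  by case=> //= w q c /andP[/eqP -> pq] lq; rewrite (up q c).
by apply: (gen n).
Qed.

Lemma nondet_tree_bp : computes nondet_accepts tree_bp f.
Proof.
move=> x; have [p [pp lp up]] := tree_bp_path x; split.
  by move=> [q [qq lq]]; move: lp; rewrite -(up q true)// lq => -[<-].
by move=> fx; exists p; split=> //; rewrite lp fx.
Qed.

Lemma parity_tree_bp : computes parity_accepts tree_bp f.
Proof.
move=> x; have [p [pp lp up]] := tree_bp_path x; split.
  move=> [k kodd kE]; have [A0|/set0P[q [qq lq]]] :=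
    eqVneq [set p | @accepting_path n tree_bp x p] set0.
    move: kE; rewrite A0 card_eq_sym card_eq0 => /eqP k0.
    by case: k kodd k0 => // k _ /seteqP[/(_ 0)]; case.
  by move: lp; rewrite -(up q true)// lq => -[<-].
move=> fx; exists 1 => //.
have -> : [set p | @accepting_path n tree_bp x p] = [set p].
  apply/seteqP; split=> q /=; first by move=> [qq lq]; exact: up lq.
  by move=> ->; split=> //; rewrite lp fx.
exact: card_set1.
Qed.

End DecisionTree.

Lemma nondet_bp_ex (n : nat) (f : boolfun n) :
  exists s, `[< has_bp_of_size nondet_accepts f s >].
Proof.
exists (bp_size (tree_bp f)); apply/asboolP.
by exists (tree_bp f) => //; exact: nondet_tree_bp.
Qed.

Lemma parity_bp_ex (n : nat) (f : boolfun n) :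
  exists s, `[< has_bp_of_size parity_accepts f s >].
Proof.
exists (bp_size (tree_bp f)); apply/asboolP.
by exists (tree_bp f) => //; exact: parity_tree_bp.
Qed.

Definition NBP : complexity_measure := fun n f => ex_minn (@nondet_bp_ex n f).

Definition ParityBP : complexity_measure := fun n f => ex_minn (@parity_bp_ex n f).

(* Main.v *)
(** A Nečiporuk function [b] is bounded through branching programs that reuse
    one shared layer for many blocks.  Take variables [u_ia] and [w_ic] for
    every block [i < q], and shared variables [z_ac] ([a, c < q]), and let the
    program follow paths [u_ia -> z_ac -> w_jc -> t_1] through variables set to
    1, for arbitrary [i, a, c, j].  With the variables of all blocks but one
    set to 0, the [q^2] bits [z] are all recovered from the subfunction on the
    remaining block, so each of the [q] blocks has at least [2^(q^2)]
    subfunctions, although there are only [3 q^2 + 1] vertices: hence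
    [b (2^(q^2)) <= 4 q].  This only uses inputs with at most one accepting
    path, so it applies to existential and to parity acceptance alike.

    For an arbitrary [n]-ary function, a block [V] has at most
    [2^(min n (2^|V|))] subfunctions.  Thus [b] is at most of order
    [n^(1/4)] on blocks with [|V| <= (log n) / 2] and of order [n^(1/2)] on the
    others, and in both cases it is
    [O (|V| n^(1/2) / log n)]; these bounds add up to [O (n^(3/2) / log n)]. *)

Require Import Defs.
From mathcomp Require Import all_boot all_order all_algebra.
From mathcomp Require Import all_classical all_reals all_analysis.
From mathcomp Require Import zify lra.

Import Order.TTheory GRing.Theory Num.Theory.
Import numFieldNormedType.Exports.

Local Open Scope nat_scope.

(** * A branching program whose middle layer is shared by all blocks *)

Section LayeredProgram.
Variable q' : nat.
Let q := q'.+1.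

Definition layered_var : finType := ('I_q * 'I_q + 'I_q * 'I_q + 'I_q * 'I_q)%type.
Notation u_ i a := (inl (inl (i, a)) : layered_var).
Notation z_ a c := (inl (inr (a, c)) : layered_var).
Notation w_ i c := (inr (i, c) : layered_var).

Definition layered_arity := #|layered_var|.

(* [None] is the start vertex; both its answers lead to the whole first layer. *)
Definition layered_arc (t : option layered_var) (b : bool) :
    pred (option layered_var + bool) :=
  fun v => match t, v with
  | None, inl (Some (inl (inl _))) => true
  | Some (inl (inl (i, a))), inl (Some (inl (inr (a', c)))) => b && (a' == a)
  | Some (inl (inr (a, c))), inl (Some (inr (j, c'))) => b && (c' == c)
  | Some (inr _), inr true => b
  | _, _ => false
  end.

(** The start vertex must query some variable; [w_ ord0 ord0] is an arbitrary choice, since the arcs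
    leaving the start ignore the answer. *)
Definition layered_bp : branching_program layered_arity :=
  @BranchingProgram layered_arity (option layered_var) (inl None)
    (fun t => enum_rank (odflt (w_ ord0 ord0) t)) layered_arc.

Definition layered_path (i a c j : 'I_q) : seq (bp_node layered_bp + bool) :=
  [:: inl (Some (u_ i a)); inl (Some (z_ a c)); inl (Some (w_ j c)); inr true].

Lemma layered_size : bp_size layered_bp = (3 * q ^ 2).+1.
Proof. by rewrite /bp_size card_option !card_sum !card_prod card_ord; lia. Qed.

Lemma layered_accepting (x : input layered_arity) p :
  @accepting_path _ layered_bp x p <->
  exists i a c j, [/\ p = layered_path i a c j, x (enum_rank (u_ i a)),
    x (enum_rank (z_ a c)) & x (enum_rank (w_ j c))].
Proof.
split; last first.
  by move=> [i [a [c [j [-> xu xz xw]]]]]; split=> //=; rewrite xu xz xw !eqxx.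
(* Arcs only lead to the next layer, so every list other than a [layered_path] fails at some arc or
   misses the sink. *)
case: p => [[]//|[[[[[i a]|?]|?]|]|?] p] [] //=.
case: p => [|[[[[?|[a' c]]|?]|]|?] p] //=; rewrite ?andbF //=.
case: p => [|[[[[?|?]|[j c']]|]|?] p] //=; rewrite ?andbF //=.
case: p => [|[[[[?|?]|[? ?]]|]|[]] p] //=; rewrite ?andbF //=.
case: p => [|? ?] /=; last by rewrite !andbF.
move=> /and4P[/andP[xu /eqP ->] /andP[xz /eqP ->] xw _] _.
by exists i, a, c, j.
Qed.

Definition layered_block_of (k : 'I_layered_arity) : option 'I_q :=
  match enum_val k with
  | inl (inl (i, _)) => Some i
  | inl (inr _) => None
  | inr (i, _) => Some i
  end.

Definition layered_block (i : 'I_q) : {set 'I_layered_arity} :=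
  [set k | layered_block_of k == Some i]%SET.

(** With a single [u_] and a single [w_] switched on, [Z] alone decides whether the only possible
    path exists. *)
Definition probe (i a c : 'I_q) (Z : {set 'I_q * 'I_q}) : input layered_arity :=
  [ffun k => match enum_val k with
             | inl (inl s) => s == (i, a)
             | inl (inr s) => s \in Z
             | inr s => s == (i, c)
             end].

Lemma probe_accepting i a c Z p :
  @accepting_path _ layered_bp (probe i a c Z) p <->
  (a, c) \in Z /\ p = layered_path i a c i.
Proof.
rewrite layered_accepting; split.
  move=> [i' [a' [c' [j [-> ]]]]]; rewrite !ffunE !enum_rankK.
  by move=> /eqP[-> ->] Zac /eqP[-> ec]; rewrite ec in Zac *.
by move=> [Zac ->]; exists i, a, c, i; rewrite !ffunE !enum_rankK !eqxx.
Qed.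

Definition probe_block i a c : {ffun {k | k \in layered_block i} -> bool} :=
  [ffun k => probe i a c finset.set0 (val k)].

(** Both [ord0] here and the empty set in [probe_block] are placeholders: [a] and [c] matter only
    inside block [i], [Z] only outside it. *)
Definition probe_rest i Z : {ffun {k | k \notin layered_block i} -> bool} :=
  [ffun k => probe i ord0 ord0 Z (val k)].

Lemma merge_probe i a c Z :
  Defs.merge (probe_block i a c) (probe_rest i Z) = probe i a c Z.
Proof.
apply/ffunP => k; rewrite ffunE.
case: {-}_ / boolP => kV; rewrite ffunE /= !ffunE; move: kV;
  rewrite inE /layered_block_of; case: enum_val => [[[i' a']|//]|[i' c']] //=;
  rewrite !xpair_eqE.
  by rewrite (_ : (Some i' == _) = (i' == i))//; case: eqP.
by rewrite (_ : (Some i' == _) = (i' == i))//; case: eqP.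
Qed.

Lemma layered_block_inj : injective layered_block.
Proof.
move=> i j /setP /(_ (enum_rank (u_ i ord0))).
by rewrite !inE /layered_block_of enum_rankK eqxx => /esym/eqP[].
Qed.

Definition layered_partition :=
  finset.preim_partition layered_block_of [set: 'I_layered_arity]%SET.

Lemma layered_block_partition i : layered_block i \in layered_partition.
Proof.
apply/imsetP; exists (enum_rank (u_ i ord0)); first by rewrite inE.
by apply/setP => k; rewrite !inE /= /layered_block_of enum_rankK eq_sym.
Qed.

End LayeredProgram.

(* Nothing is required when there are several accepting paths. *)
Definition decides_unique_path (acc : acceptance) :=
  forall n (B : branching_program n) x,
    ((forall p, ~ @accepting_path _ B x p) -> ~ acc n B x) /\
    (forall p0, (forall p, @accepting_path _ B x p <-> p = p0) -> acc n B x).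

Lemma nondet_decides_unique_path : decides_unique_path nondet_accepts.
Proof.
move=> n B x; split=> [noB [p /noB]//|p0 uB].
by exists p0; apply/uB.
Qed.

Lemma parity_decides_unique_path : decides_unique_path parity_accepts.
Proof.
move=> n B x; split=> [noB [k kodd]|p0 uB].
  rewrite (_ : mkset _ = set0); last by apply/seteqP; split=> p //= /noB.
  rewrite card_eq_sym card_eq0 => /eqP k0.
  by case: k kodd k0 => // k _ /seteqP[/(_ 0)]; case.
exists 1 => //; rewrite (_ : mkset _ = [set p0]%classic) ?card_set1//.
by apply/seteqP; split=> p /uB.
Qed.

Section NeciporukBound.
Variables (acc : acceptance) (M : complexity_measure).
Hypothesis acc_unique : decides_unique_path acc.
Hypothesis M_le_size : forall n (f : boolfun n) (B : branching_program n),
  computes acc B f -> M n f <= bp_size B.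

Definition layered_fun q' : boolfun (layered_arity q') :=
  [ffun x => `[< acc _ (layered_bp q') x >]].

Lemma layered_fun_probe q' i a c Z :
  layered_fun q' (probe q' i a c Z) = ((a, c) \in Z).
Proof.
have [no_path one_path] := acc_unique _ (layered_bp q') (probe q' i a c Z).
rewrite ffunE; apply/asboolP/idP.
  apply: contraPT => /negP nZ; apply: no_path => p.
  by rewrite probe_accepting => -[].
move=> Zac; apply: (one_path (layered_path q' i a c i)) => p.
by rewrite probe_accepting; split=> [[]|].
Qed.

Lemma layered_nb_subfunctions q' i :
  2 ^ (q'.+1 ^ 2) <= nb_subfunctions (layered_block q' i) (layered_fun q').
Proof.
pose g Z := subfunction (layered_fun q') (probe_rest q' i Z).
have gE Z a c : g Z (probe_block q' i a c) = ((a, c) \in Z).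
  by rewrite [LHS]ffunE merge_probe layered_fun_probe.
have g_inj : injective g.
  by move=> Z Z' gZ; apply/setP => -[a c]; rewrite -!gE gZ.
rewrite (_ : 2 ^ _ = #|g @: [set: {set 'I_q'.+1 * 'I_q'.+1}]%SET|).
  by apply: subset_leq_card; apply/fintype.subsetP => _ /imsetP[Z _ ->]; apply: imset_f.
rewrite card_imset// cardsT -cardsT -powersetT card_powerset cardsT.
by rewrite card_prod card_ord.
Qed.

Lemma neciporuk_square_le b q' : neciporuk_function M b ->
  b (2 ^ (q'.+1 ^ 2)) <= 4 * q'.+1.
Proof.
move=> [b_mono b_le].
have computesB : computes acc (layered_bp q') (layered_fun q').
  by move=> x; rewrite ffunE; split=> [?|/asboolP//]; apply/asboolP.
have := leq_trans (b_le _ (layered_fun q') (layered_partition q')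
  (finset.preim_partitionP _ _)) (M_le_size _ _ _ computesB).
rewrite layered_size /neciporuk_sum.
set blocks := (layered_block q' @: [set: 'I_q'.+1])%SET.
have /finset.setIidPr blocksE : blocks \subset layered_partition q'.
  by apply/fintype.subsetP => _ /imsetP[i _ ->]; apply: layered_block_partition.
(* The class of the shared variables is dropped from the sum. *)
rewrite (big_setID blocks) blocksE /= => /(leq_trans (leq_addr _ _)).
rewrite big_imset /=; last by move=> i j _ _; apply: layered_block_inj.
have : \sum_(i in [set: 'I_q'.+1]%SET) b (2 ^ (q'.+1 ^ 2)) <=
    \sum_(i in [set: 'I_q'.+1]%SET)
      b (nb_subfunctions (layered_block q' i) (layered_fun q')).
  by apply: leq_sum => i _; apply: b_mono; rewrite ?expn_gt0 ?layered_nb_subfunctions.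
rewrite sum_nat_const cardsT card_ord => /leq_trans h/h.
(* With [q = q'.+1]: [q * B <= 3 * q ^ 2 + 1 <= 4 * q ^ 2]; divide by [q]. *)
set B := b _ => {h}; nia.
Qed.

(** The case [q = 2 ^ k], extended to smaller arguments by monotonicity. *)
Lemma neciporuk_le b k m : neciporuk_function M b ->
  0 < m -> m <= 2 ^ 2 ^ k.*2 -> b m <= 4 * 2 ^ k.
Proof.
move=> bM m_gt0 m_le; apply: (leq_trans (bM.1 _ _ m_gt0 m_le)).
have := neciporuk_square_le b (2 ^ k).-1 bM.
by rewrite prednK ?expn_gt0// -expnM muln2.
Qed.

Lemma nb_subfunctions_gt0 n (V : {set 'I_n}) (f : boolfun n) :
  0 < nb_subfunctions V f.
Proof.
by apply/card_gt0P; exists (subfunction f [ffun=> false]); apply: imset_f.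
Qed.

Lemma nb_subfunctions_le_block n (V : {set 'I_n}) (f : boolfun n) :
  nb_subfunctions V f <= 2 ^ 2 ^ #|V|.
Proof.
apply: leq_trans (max_card _) _.
by rewrite !card_ffun card_bool card_sig (eq_card (_ : _ =i V)).
Qed.

Lemma nb_subfunctions_le_arity n (V : {set 'I_n}) (f : boolfun n) :
  nb_subfunctions V f <= 2 ^ n.
Proof.
apply: leq_trans (leq_imset_card _ _) _.
rewrite card_ffun card_bool card_sig leq_exp2l//.
by apply: leq_trans (max_card _) _; rewrite card_ord.
Qed.

(** Blocks with [K <= #|V|] use the bound [2 ^ n] on the number of subfunctions, smaller ones use
    [2 ^ 2 ^ #|V|]. *)
Lemma neciporuk_block_le b n (f : boolfun n) (V : {set 'I_n}) K :
  neciporuk_function M b -> n <= 2 ^ K.*2 -> 0 < #|V| ->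
  b (nb_subfunctions V f) * K <= 8 * 2 ^ K * #|V|.
Proof.
move=> bM nK V_gt0; have r_gt0 := nb_subfunctions_gt0 _ V f.
have [KV|VK] := leqP K #|V|.
  have := neciporuk_le b K _ bM r_gt0 (leq_trans (nb_subfunctions_le_arity _ V f) _).
  by rewrite leq_exp2l// => /(_ nK); set B := b _; nia.
(* From [#|V| < K] follows [#|V| <= K./2.*2]. *)
have : b (nb_subfunctions V f) <= 4 * 2 ^ K./2.
  apply: neciporuk_le => //; apply: leq_trans (nb_subfunctions_le_block _ V f) _.
  by rewrite !leq_exp2l//; lia.
(* For [x = 2 ^ K./2], [K < 2 * x], so the product is at most [4 * x * 2 * x <= 8 * 2 ^ K]. *)
have := ltn_expl K./2 (ltnSn 1); have : 2 ^ K./2 * 2 ^ K./2 <= 2 ^ K.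
  by rewrite -expnD leq_exp2l//; lia.
by have := odd_double_half K; set B := b _; set x := 2 ^ _; set y := 2 ^ _; nia.
Qed.

Lemma best_bound_le (F : forall n, boolfun n) n K : n <= 2 ^ K.*2 ->
  best_bound M F n * K <= 8 * 2 ^ K * n.
Proof.
move=> nK; rewrite /best_bound; case: ex_maxnP => l /asboolP[b [P [bM PT <-]]] _.
have := card_partition PT; rewrite cardsT card_ord => nE.
rewrite /neciporuk_sum [X in _ <= _ * X]nE big_distrl big_distrr /=.
apply: leq_sum => V VP; apply: neciporuk_block_le => //.
rewrite card_gt0; apply: contraTneq VP => ->.
by case/and3P: PT.
Qed.

End NeciporukBound.

(** * Passage to real asymptotics *)

Local Open Scope classical_set_scope.
Local Open Scope ring_scope.

(** Since [log2 n <= 2 K] and [2 ^ K <= 2 sqrt n], [l log2 n <= 16 * 2 ^ K * n <= 32 n^(3/2)]. *)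
Lemma le_pow3half_div_log2 (R : realType) (n K l : nat) :
  (1 < n)%N -> (n <= 2 ^ K.*2)%N -> (2 ^ K.*2 <= 4 * n)%N ->
  (l * K <= 8 * 2 ^ K * n)%N ->
  l%:R <= 32 * (n%:R `^ (3 / 2) / (ln n%:R / ln 2)) :> R.
Proof.
move=> n_gt1 nK Kn lK; have n0 : (0 : R) < n%:R by rewrite ltr0n ltnW.
have ln2_gt0 : (0 : R) < ln 2 by rewrite ln_gt0// ltr1n.
have lnn_gt0 : (0 : R) < ln n%:R by rewrite ln_gt0// ltr1n.
have log_le : ln n%:R / ln 2 <= K%:R * 2 :> R.
  rewrite ler_pdivrMr// -natrM muln2 mulr_natl -lnXn// ler_ln ?posrE ?exprn_gt0//.
  by rewrite -natrX ler_nat.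
have -> : n%:R `^ (3 / 2) = n%:R * Num.sqrt n%:R :> R.
  rewrite (_ : 3 / 2 = 1 + 2^-1); last by lra.
  by rewrite powRD ?gt_eqF ?implybT// powRr1 ?powR12_sqrt ?ltW.
have pow_le : 2 ^+ K <= 2 * Num.sqrt n%:R :> R.
  rewrite -ler_sqr ?nnegrE ?exprn_ge0 ?mulr_ge0 ?sqrtr_ge0//.
  move: Kn; rewrite exprMn (sqr_sqrtr (ltW n0)) -exprM muln2 -(ler_nat R) natrM natrX.
  by move=> /le_trans; apply; lra.
move: lK; rewrite -(ler_nat R) !natrM natrX => lK.
rewrite mulrA ler_pdivlMr ?divr_gt0//.
apply: le_trans (ler_wpM2l (ler0n _ l) log_le) _; rewrite mulrA.
apply: le_trans (ler_wpM2r (ler0n _ 2) lK) _.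
have := ler_wpM2r (ltW n0) pow_le; lra.
Qed.

Lemma best_bound_bigO (R : realType) (acc : acceptance) (M : complexity_measure)
    (F : forall n : nat, boolfun n) :
  decides_unique_path acc ->
  (forall n (f : boolfun n) (B : branching_program n),
     computes acc B f -> (M n f <= bp_size B)%N) ->
  (fun n : nat => (best_bound M F n)%:R : R) =O_\oo
     (fun n : nat => n%:R `^ (3 / 2) / (ln n%:R / ln 2) : R).
Proof.
move=> acc_unique M_le_size; apply/eqO_exP; exists 32 => //.
near=> n; have n_gt1 : (1 < n)%N by near: n; exact: nbhs_infty_ge.
have := trunc_log_ltn n (ltnSn 1); have := trunc_logP (ltnSn 1) (ltnW n_gt1).
set L := trunc_log 2 n => Ln nL.
(* The choice [K = L./2.+1] puts [4 ^ K] between [n] and [4 * n]. *)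
have nK : (n <= 2 ^ L./2.+1.*2)%N.
  by apply: ltnW; apply: leq_trans nL _; rewrite leq_exp2l//; lia.
have Kn : (2 ^ L./2.+1.*2 <= 4 * n)%N.
  have : (2 ^ L./2.*2 <= n)%N by apply: leq_trans Ln; rewrite leq_exp2l//; lia.
  by rewrite doubleS !expnS; lia.
have lK := best_bound_le _ _ acc_unique M_le_size F _ _ nK.
rewrite ger0_norm// ger0_norm; first exact: le_pow3half_div_log2 nK Kn lK.
by rewrite divr_ge0 ?powR_ge0 ?divr_ge0 ?ln_ge0 ?ler1n// ltnW.
Unshelve. all: by end_near. Qed.

Theorem theorem6p4 (R : realType) (F : forall n : nat, boolfun n) :
  ((fun n : nat => (best_bound NBP F n)%:R : R) =O_\oo
     (fun n : nat => n%:R `^ (3 / 2) / (ln n%:R / ln 2) : R)) /\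
  ((fun n : nat => (best_bound ParityBP F n)%:R : R) =O_\oo
     (fun n : nat => n%:R `^ (3 / 2) / (ln n%:R / ln 2) : R)).
Proof.
split.
  apply: (best_bound_bigO _ nondet_accepts); first exact: nondet_decides_unique_path.
  move=> n f B Bf; rewrite /NBP; case: ex_minnP => s _; apply.
  by apply/asboolP; exists B.
apply: (best_bound_bigO _ parity_accepts); first exact: parity_decides_unique_path.
move=> n f B Bf; rewrite /ParityBP; case: ex_minnP => s _; apply.
by apply/asboolP; exists B.
Qed.
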